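(* Let $e\ge 1$ and $r\ge 2$ be integers. The braid monoid $\mathbf{B}^{\oplus}(e,e,r)$ is a Garside monoid.
   Context: $\mathbf{B}^{\oplus}(e,e,r)$ is the monoid defined by the monoid presentation $\mathcal{P}^{\oplus}(e,e,r)$ with generators $T_e\cup S_r$, where $T_e=\{t_i\mid i\in\mathbb{Z}/e\}$ and $S_r=\{s_3,\dots,s_r\}$ (empty if $r=2$), and relations: (R1) $s_is_js_i=s_js_is_j$ for $|i-j|=1$; (R2) $s_is_j=s_js_i$ for $|i-j|>1$; (R3) $s_3t_is_3=t_is_3t_i$ for $i\in\mathbb{Z}/e$; (R4) $s_jt_i=t_is_j$ for $i\in\mathbb{Z}/e$ and $4\le j\le r$; (R5) $t_it_{i-1}=t_jt_{j-1}$ for $i,j\in\mathbb{Z}/e$. Relations involving $s_j$ occur only when $3\le j\le r$. In a monoid $M$, write $x\preccurlyeq y$ ($x$ left-divides $y$, $y$ is a right multiple of $x$) if $xz=y$ for some $z\in M$, and $y\succcurlyeq x$ ($x$ right-divides $y$) if $y=zx$ for some $z\in M$. A Garside monoid is a cancellative monoid with lcm's and gcd's (for left and for right divisibility) that admits a Garside element, namely an element whose left and right divisors coincide, are finite in number, and generate $M$. *)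

(* Defs.v *)
From HB Require Import structures.
From mathcomp Require Import all_boot all_order all_algebra.
From mathcomp Require Import boolp classical_sets functions cardinality.

Set Implicit Arguments.
Unset Strict Implicit.
Unset Printing Implicit Defensive.

Local Open Scope classical_set_scope.
Local Open Scope group_scope.

Section Presentation.
Variables (X : choiceType) (R : seq X -> seq X -> Prop).

Inductive pres_cong : seq X -> seq X -> Prop :=
| pres_cong_rel u v of R u v : pres_cong u v
| pres_cong_refl u : pres_cong u u
| pres_cong_sym u v of pres_cong u v : pres_cong v u
| pres_cong_trans u v w of pres_cong u v & pres_cong v w : pres_cong u w
| pres_cong_cat u u' v v' of pres_cong u u' & pres_cong v v' :
    pres_cong (u ++ v) (u' ++ v').

Definition pres_congb : rel (seq X) := fun u v => `[< pres_cong u v >].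

Lemma pres_congb_refl : reflexive pres_congb.
Proof. by move=> u; apply/asboolP; exact: pres_cong_refl. Qed.

Lemma pres_congb_sym : symmetric pres_congb.
Proof. by move=> u v; apply/asboolP/asboolP; exact: pres_cong_sym. Qed.

Lemma pres_congb_trans : transitive pres_congb.
Proof.
by move=> v u w /asboolP uv /asboolP vw; apply/asboolP; exact: pres_cong_trans vw.
Qed.

Canonical pres_equiv :=
  EquivRel pres_congb pres_congb_refl pres_congb_sym pres_congb_trans.

Local Open Scope quotient_scope.

Definition presented_monoid := {eq_quot pres_equiv}.

HB.instance Definition _ := Choice.on presented_monoid.
HB.instance Definition _ := EqQuotient.on presented_monoid.

Lemma pres_eqP (u v : seq X) :
  \pi_presented_monoid u = \pi_presented_monoid v <-> pres_cong u v.
Proof. by split=> [/eqmodP/asboolP|uv] //; apply/eqmodP/asboolP. Qed.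

Definition pres_one : presented_monoid := \pi_presented_monoid [::].

Definition pres_mul (x y : presented_monoid) : presented_monoid :=
  \pi_presented_monoid (repr x ++ repr y).

Lemma pres_mul_pi (u v : seq X) :
  pres_mul (\pi_presented_monoid u) (\pi_presented_monoid v)
  = \pi_presented_monoid (u ++ v).
Proof. by apply/pres_eqP/pres_cong_cat; apply/pres_eqP; exact: reprK. Qed.

Lemma pres_mulA : associative pres_mul.
Proof.
elim/quotW=> u; elim/quotW=> v; elim/quotW=> w.
by rewrite (pres_mul_pi v w) (pres_mul_pi u v) !(pres_mul_pi u, pres_mul_pi (u ++ v)) catA.
Qed.

Lemma pres_mul1l : left_id pres_one pres_mul.
Proof. by elim/quotW=> u; exact: pres_mul_pi. Qed.

Lemma pres_mul1r : right_id pres_one pres_mul.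
Proof. by elim/quotW=> u; rewrite pres_mul_pi cats0. Qed.

HB.instance Definition _ :=
  isMonoid.Build presented_monoid pres_mulA pres_mul1l pres_mul1r.

End Presentation.

Section Garside.
Variable M : monoidType.
Implicit Types (x y m n d : M) (A : set M) (dvd : M -> M -> Prop).

Definition ldvd x y := exists z, x * z = y.
Definition rdvd x y := exists z, z * x = y.

Definition is_lcm dvd x y m :=
  [/\ dvd x m, dvd y m & forall n, dvd x n -> dvd y n -> dvd m n].

Definition is_gcd dvd x y d :=
  [/\ dvd d x, dvd d y & forall n, dvd n x -> dvd n y -> dvd n d].

Definition has_lcms_gcds dvd :=
  forall x y, (exists m, is_lcm dvd x y m) /\ (exists d, is_gcd dvd x y d).

Definition cancellative :=
  (forall x y z, x * y = x * z -> y = z) /\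
  (forall x y z, y * x = z * x -> y = z).

Definition generates A :=
  forall x, exists2 s : seq M, (forall d, d \in s -> A d) &
    x = \big[*%g/1]_(d <- s) d.

Definition garside_element D :=
  [/\ [set x | ldvd x D] = [set x | rdvd x D],
      finite_set [set x | ldvd x D] &
      generates [set x | ldvd x D]].

Definition garside_monoid :=
  [/\ cancellative, has_lcms_gcds ldvd, has_lcms_gcds rdvd &
      exists D, garside_element D].

End Garside.

Section BraidMonoid.
Variables e r : nat.

(* Z/e is encoded as 'I_e, which stays correct for e = 1 (unlike 'Z_e), and
   i - 1 in Z/e as [ord_pred i]. *)
Definition sindex : Type := {j : 'I_r.+1 | (3 <= j)%N}.
Definition gen : Type := ('I_e + sindex)%type.
HB.instance Definition _ := Finite.on gen.

Definition tgen (i : 'I_e) : gen := inl i.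
Definition sgen (j : sindex) : gen := inr j.

Definition idx (j : sindex) : nat := val (val j).

Inductive braid_rel : seq gen -> seq gen -> Prop :=
| braid_R1 (i j : sindex) of `|idx i - idx j|%N = 1%N :
    braid_rel [:: sgen i; sgen j; sgen i] [:: sgen j; sgen i; sgen j]
| braid_R2 (i j : sindex) of (1 < `|idx i - idx j|)%N :
    braid_rel [:: sgen i; sgen j] [:: sgen j; sgen i]
| braid_R3 (j : sindex) (i : 'I_e) of idx j = 3%N :
    braid_rel [:: sgen j; tgen i; sgen j] [:: tgen i; sgen j; tgen i]
| braid_R4 (j : sindex) (i : 'I_e) of (4 <= idx j)%N :
    braid_rel [:: sgen j; tgen i] [:: tgen i; sgen j]
| braid_R5 (i j : 'I_e) :
    braid_rel [:: tgen i; tgen (ord_pred i)] [:: tgen j; tgen (ord_pred j)].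

Definition braid_monoid : monoidType := presented_monoid braid_rel.

End BraidMonoid.

(* Main.v *)
Require Import Defs.
From mathcomp Require Import all_boot ssralg ssrint zify.
From mathcomp Require Import boolp classical_sets cardinality.

(* The relations preserve length, and each pair of distinct letters a, b is the
   pair of first letters of exactly one relation a c(a,b) = b c(b,a).  If x, y
   satisfy a x = b y, then x = c(a,b) z and y = c(b,a) z for some z: along a
   chain of elementary transformations this follows by induction on the length
   as soon as the complement c satisfies a cube condition on triples of letters.
   Left cancellativity and the existence of right lcm's of elements having a
   common right multiple follow.  Since t_i t_{i-1} does not depend on i, the
   letters of T_e behave in the cube condition like a single Coxeter generator,
   up to the shift i -> i-1.

   Put L_2 = t_i t_{i-1} and L_k = s_k L_{k-1} s_k.  The L_k commute with each
   other, and Delta = L_2 L_3 ... L_r satisfies s_j Delta = Delta s_j and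
   t_i Delta = Delta t_{i-r}.  All letters divide Delta, so powers of Delta are
   common multiples of arbitrary elements and Delta is a Garside element.

   The statements about right divisibility come from the anti-automorphism that
   reverses words and maps t_i to t_{-1-i}. *)

Set Implicit Arguments.
Unset Strict Implicit.
Unset Printing Implicit Defensive.

Local Open Scope group_scope.

(** * Left divisibility, lcm's and gcd's under left cancellation and an additive length *)

Section LeftDivisibility.
Variable M : monoidType.
Implicit Types x y z m d D : M.

Lemma ldvd_refl x : ldvd x x.
Proof. by exists 1; rewrite mulg1. Qed.

Lemma ldvd_trans x y z : ldvd x y -> ldvd y z -> ldvd x z.
Proof. by move=> [u <-] [v <-]; exists (u * v); rewrite mulgA. Qed.

Lemma ldvd_mulr x y : ldvd x (x * y).
Proof. by exists y. Qed.

Lemma ldvd_mul2l x y z : ldvd y z -> ldvd (x * y) (x * z).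
Proof. by move=> [u <-]; exists u; rewrite mulgA. Qed.

Hypothesis cancl : forall x y z, x * y = x * z -> y = z.

Lemma ldvd_cancell x y z : ldvd (x * y) (x * z) -> ldvd y z.
Proof. by move=> [u]; rewrite -mulgA => /cancl <-; exists u. Qed.

Lemma is_lcm_mul2l x y z m :
  is_lcm (@ldvd M) y z m -> is_lcm (@ldvd M) (x * y) (x * z) (x * m).
Proof.
move=> [ym zm mP]; split; try exact: ldvd_mul2l.
move=> n xyn xzn; have [v def_n] : ldvd x n by apply: ldvd_trans xyn; exists y.
rewrite -def_n in xyn xzn *.
by apply: ldvd_mul2l; apply: mP; apply: (@ldvd_cancell x).
Qed.

Variable len : M -> nat.
Hypothesis lenM : forall x y, len (x * y) = (len x + len y)%N.
Hypothesis len0 : forall x, len x = 0%N -> x = 1.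

(** A common left divisor [d] of maximal length is the gcd: for another common divisor [c], the lcm
    of [d] and [c] still divides [x] and [y], so by maximality it is no longer than [d], hence equal
    to [d]. *)
Lemma is_gcd_of_lcms :
    (forall x y, exists m, is_lcm (@ldvd M) x y m) ->
  forall x y, exists d, is_gcd (@ldvd M) x y d.
Proof.
move=> lcms x y.
pose Q n := `[< exists d, [/\ ldvd d x, ldvd d y & len d = n] >].
have exQ : exists n, Q n.
  by exists (len 1); apply/asboolP; exists 1; split=> //; [exists x|exists y]; rewrite mul1g.
have bndQ n : Q n -> (n <= len x)%N.
  by move=> /asboolP[d [[z <-] _ <-]]; rewrite lenM leq_addr.
have [n /asboolP[d [dx dy lend]] maxn] := ex_maxnP exQ bndQ.
exists d; split=> // c cx cy; have [m [dm cm mP]] := lcms d c.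
have /maxn : Q (len m) by apply/asboolP; exists m; split=> //; apply: mP.
case: dm => z def_m; rewrite -lend -def_m lenM => lez.
by move: cm; rewrite -def_m (len0 (x := z)) ?mulg1 //; lia.
Qed.

End LeftDivisibility.

(** * Quasi-central elements divisible by all generators *)

Section QuasiCentral.
Variables (M : monoidType) (X : Type) (g : X -> M).
Hypothesis gen_ind :
  forall P : M -> Prop, P 1 -> (forall a x, P x -> P (g a * x)) -> forall x, P x.
Implicit Types x y z D : M.

Lemma gen_ind_r (P : M -> Prop) :
  P 1 -> (forall a x, P x -> P (x * g a)) -> forall x, P x.
Proof.
(* The factor [1] is generalized to a prefix [y] satisfying [P], which absorbs the letters of [x]
   one at a time. *)
move=> P1 PM x; rewrite -[x]mul1g; elim/gen_ind: x 1 P1 => [y|a x IH y] Py.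
  by rewrite mulg1.
by rewrite mulgA; apply/IH/PM.
Qed.

Variable D : M.
Hypothesis pushl : forall a, exists x, g a * D = D * x.
Hypothesis pushr : forall a, exists x, x * D = D * g a.
Hypothesis genD : forall a, ldvd (g a) D.

Lemma quasicentral_pushl x : exists y, x * D = D * y.
Proof.
elim/gen_ind: x => [|a x [y IH]]; first by exists 1; rewrite mul1g mulg1.
by have [z az] := pushl a; exists (z * y); rewrite -mulgA IH !mulgA az.
Qed.

Lemma quasicentral_pushr x : exists y, y * D = D * x.
Proof.
elim/gen_ind: x => [|a x [y IH]]; first by exists 1; rewrite mul1g mulg1.
by have [z az] := pushr a; exists (z * y); rewrite -mulgA IH !mulgA az.
Qed.

(** If [x * z = D ^+ n], [g a * w = D] and [z * D = D * z'], then [x * g a * w * z' = x * D * z' = x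
    * z * D = D ^+ n.+1]. *)
Lemma quasicentral_ldvd_power x : exists n, ldvd x (D ^+ n).
Proof.
elim/gen_ind_r: x => [|a x [n [z def_Dn]]].
  by exists 0; exact: ldvd_refl.
have [w aw] := genD a; have [z' zz'] := quasicentral_pushl z.
by exists n.+1, (w * z'); rewrite expgSr -def_Dn -!mulgA zz' -aw !mulgA.
Qed.

Lemma quasicentral_common_multiple x y : exists m, ldvd x m /\ ldvd y m.
Proof.
have [n xn] := quasicentral_ldvd_power x.
have [k yk] := quasicentral_ldvd_power y.
exists (D ^+ (n + k)); split.
  by apply: ldvd_trans xn _; rewrite expgnDr; exact: ldvd_mulr.
by apply: ldvd_trans yk _; rewrite addnC expgnDr; exact: ldvd_mulr.
Qed.

(** If [x * y = D] and [z * D = D * y], then [z * x * y = D * y], so [z * x = D] by right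
    cancellation; the converse is symmetric. *)
Lemma quasicentral_garside :
  cancellative M -> finite_set [set x | ldvd x D]%classic -> garside_element D.
Proof.
move=> [cancl cancr] finD; split=> //.
- apply/seteqP; split=> x /= [y def_D].
    have [z zy] := quasicentral_pushr y.
    by exists z; apply: (cancr y); rewrite -mulgA def_D.
  have [z yz] := quasicentral_pushl y.
  by exists z; apply: (cancl y); rewrite mulgA def_D.
- move=> x; elim/gen_ind: x => [|a x [s sD ->]].
    by exists [::]; rewrite ?big_nil.
  exists (g a :: s); last by rewrite big_cons.
  by move=> d; rewrite in_cons => /orP[/eqP-> | /sD //]; exact: genD.
Qed.

End QuasiCentral.

(** * Length-preserving complemented presentations: left cancellation and right lcm's *)

Section HomogeneousPresentation.
Variables (X : choiceType) (R : seq X -> seq X -> Prop).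
Local Notation M := (presented_monoid R).
Implicit Types (a b d : X) (u v : seq X) (x y z : M).

Definition word u : M := (\pi_(presented_monoid R) u)%qT.
Local Notation "a ** x" := (word [:: a] * x) (at level 38, right associativity).

Lemma word_eqP u v : word u = word v <-> pres_cong R u v.
Proof. exact: pres_eqP. Qed.

Lemma word_cat u v : word (u ++ v) = word u * word v.
Proof. exact/esym/pres_mul_pi. Qed.

Lemma word_cons a u : word (a :: u) = a ** word u.
Proof. exact: (word_cat [:: a]). Qed.

Lemma foldr_word u x : foldr (fun a y => a ** y) x u = word u * x.
Proof.
elim: u => [|a u IH] /=; first exact/esym/mul1g.
by rewrite IH [in RHS]word_cons mulgA.
Qed.

(** For concrete words both sides simplify to right-nested products ending in [x], so that a
    relation can be used for rewriting in front of any tail. *)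
Lemma foldr_word_cong u v x : pres_cong R u v ->
  foldr (fun a y => a ** y) x u = foldr (fun a y => a ** y) x v.
Proof. by rewrite !foldr_word => /word_eqP->. Qed.

Lemma word_nil : word [::] = 1.
Proof. by []. Qed.

Lemma word_surj x : exists u, x = word u.
Proof. by exists (repr x); rewrite /word reprK. Qed.

Lemma word_ind (P : M -> Prop) :
  P 1 -> (forall a x, P x -> P (a ** x)) -> forall x, P x.
Proof.
move=> P1 PM x; have [u ->] := word_surj x.
by elim: u => [|a u IH] //; rewrite word_cons; exact: PM.
Qed.

Hypothesis R_size : forall u v, R u v -> size u = size v.

Lemma pres_cong_size u v : pres_cong R u v -> size u = size v.
Proof.
by elim=> [|||? ? ? _ -> _ ->|? ? ? ? _ eu _ ev] //; rewrite !size_cat eu ev.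
Qed.

Definition len x := size (repr x).

Lemma len_word u : len (word u) = size u.
Proof. by apply: pres_cong_size; apply/word_eqP; exact: reprK. Qed.

Lemma lenM x y : len (x * y) = (len x + len y)%N.
Proof.
have [u ->] := word_surj x; have [v ->] := word_surj y.
by rewrite -word_cat !len_word size_cat.
Qed.

Lemma len_cons a x : len (a ** x) = (len x).+1.
Proof. by rewrite lenM len_word. Qed.

Lemma len_eq0 x : len x = 0%N -> x = 1.
Proof. by have [u ->] := word_surj x; rewrite len_word => /size0nil->. Qed.

Variable c : X -> X -> seq X.
Hypothesis c_id : forall a, c a a = [::].
Hypothesis R_compl : forall u v, R u v ->
  u = v \/ exists a b, u = a :: c a b /\ v = b :: c b a.
Hypothesis c_compl : forall a b, word (a :: c a b) = word (b :: c b a).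

(** By [c_compl], this exhibits [a ** x] and [b ** y] as the same right multiple of the word
    [a :: c a b], the intended lcm of the letters [a] and [b]. *)
Definition compl_eq a b x y :=
  exists z, x = word (c a b) * z /\ y = word (c b a) * z.

(* The cube condition only has to be checked against elements that are shorter
   than the common multiple under consideration, where [compl_eq] may be assumed. *)
Hypothesis cube : forall n,
    (forall a b x y, a ** x = b ** y -> (len x < n)%N -> compl_eq a b x y) ->
  forall a b d x y w, (len y <= n)%N ->
    compl_eq a b x y -> compl_eq b d y w -> compl_eq a d x w.

Lemma compl_eq_refl a x : compl_eq a a x x.
Proof. by exists x; rewrite c_id word_nil mul1g. Qed.

Lemma compl_eq_sym a b x y : compl_eq a b x y -> compl_eq b a y x.
Proof. by move=> [z []]; exists z. Qed.

Lemma cons_eq_compl a b x y : a ** x = b ** y -> compl_eq a b x y.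
Proof.
(* The claim is extended to arbitrary congruent words, empty ones included, to allow an inner
   induction on the derivation of the congruence inside an induction on a length bound. *)
suff H n u v : pres_cong R u v -> (size u <= n)%N ->
    (u = [::] /\ v = [::]) \/
    exists a b u' v', [/\ u = a :: u', v = b :: v' & compl_eq a b (word u') (word v')].
  have [u ->] := word_surj x; have [v ->] := word_surj y.
  rewrite -!word_cons => /word_eqP/H/(_ (leqnn _)).
  by case=> [[]|[a' [b' [u' [v' [[-> ->] [-> ->]]]]]]].
elim: n u v => [|n IHn] u v.
  move=> /pres_cong_size suv; rewrite leqn0 => /eqP su.
  by left; split; apply: size0nil; rewrite -?suv.
have IH a' b' x' y' : a' ** x' = b' ** y' -> (len x' < n)%N -> compl_eq a' b' x' y'.
  have [u' ->] := word_surj x'; have [v' ->] := word_surj y'.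
  rewrite -!word_cons len_word => /word_eqP/IHn H lt_u'n.
  by case: (H lt_u'n) => [[]|[? [? [? [? [[-> ->] [-> ->]]]]]]].
elim=> {u v} [u v ruv|[|a' u]|u v uv IHuv lv|u v w uv IHuv vw IHvw lu
             |u u' v v' uu' IHu vv' IHv luv].
- case: (R_compl ruv) => [<-|[a' [b' [-> ->]]] _].
    case: u {ruv} => [|a' u] _; [by left|right].
    by exists a', a', u, u; split=> //; exact: compl_eq_refl.
  right; exists a', b', (c a' b'), (c b' a'); split=> //.
  by exists 1; rewrite !mulg1.
- by left.
- by right; exists a', a', u, u; split=> //; exact: compl_eq_refl.
- rewrite -(pres_cong_size uv) in lv.
  case: (IHuv lv) => [[]|[a' [b' [u' [v' [-> -> H]]]]]]; first by left.
  by right; exists b', a', v', u'; split=> //; exact: compl_eq_sym.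
(* Transitivity is where [cube] enters: the tail of the middle word has length at most [n], and [IH]
   covers the equations between shorter words. *)
- have lv : (size v <= n.+1)%N by rewrite -(pres_cong_size uv).
  case: (IHuv lu) (IHvw lv) => [[-> ->]|[a' [b' [u1 [v1 [-> def_v H]]]]]].
    by case=> [[]|[? [? [? [? []]]]]] //; left.
  rewrite def_v in lv *; case=> [[]|[? [d [? [w1 [[<- <-] -> H']]]]]] //; right.
  exists a', d, u1, w1; split=> //.
  by apply: cube IH _ _ _ _ _ _ _ H H'; rewrite len_word.
- rewrite size_cat in luv; move: (IHu (leq_trans (leq_addr _ _) luv)).
  case=> [[-> ->]|]; first exact/IHv/(leq_trans (leq_addl _ _) luv).
  move=> [a' [b' [u1 [v1 [-> -> [z [u1E v1E]]]]]]]; right.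
  exists a', b', (u1 ++ v), (v1 ++ v'); split=> //; exists (z * word v).
  rewrite !word_cat u1E v1E -!mulgA; split=> //.
  by congr (_ * (_ * _)); apply/word_eqP/pres_cong_sym.
Qed.

Lemma presented_cancell x y z : x * y = x * z -> y = z.
Proof.
elim/word_ind: x => [|a x IH]; first by rewrite !mul1g.
rewrite -!mulgA => /cons_eq_compl[w []].
by rewrite c_id word_nil !mul1g => xy xz; apply: IH; rewrite xy xz.
Qed.

(** Induction on the length of [m]. For [x = a u] and [y = b v], the lcm of [x] and [b] is [a ** l1]
    with [l1] the lcm of [u] and [c a b]. It equals [b ** (word (c b a) * l2)], and its lcm with [y]
    is [b ** l3] with [l3] the lcm of [v] and [word (c b a) * l2]. Both inner lcm's concern divisors
    of an element shorter than [m]. *)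
Lemma presented_lcm x y m :
  ldvd x m -> ldvd y m -> exists l, is_lcm (@ldvd M) x y l.
Proof.
have one_lcm z : is_lcm (@ldvd M) 1 z z.
  by split=> //; [exists z; rewrite mul1g | exact: ldvd_refl].
have is_lcmC (p q l : M) : is_lcm (@ldvd M) p q l -> is_lcm (@ldvd M) q p l.
  by case=> pl ql lP; split=> // n qn pn; exact: lP.
elim: {m}(len m) {-2}m (leqnn (len m)) x y => [|n IHn] m lem x y.
  move: lem; rewrite leqn0 => /eqP/len_eq0-> [x' xx'] _.
  exists y; suff -> : x = 1 by exact: one_lcm.
  apply: len_eq0; have /eqP := congr1 len xx'.
  by rewrite lenM -word_nil len_word addn_eq0 => /andP[/eqP].
have [u def_x] := word_surj x; case: u def_x => [|a u] ->.
  by exists y; exact: one_lcm.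
have [v def_y] := word_surj y; case: v def_y => [|b v] -> {x y}.
  by exists (word (a :: u)); apply/is_lcmC/one_lcm.
rewrite (word_cons a) (word_cons b) => -[p ap] [q bq].
have [z [upz vqz]] : compl_eq a b (word u * p) (word v * q).
  by apply: cons_eq_compl; rewrite !mulgA ap.
have lu : (len (word u * p)%g <= n)%N by rewrite -ltnS -(len_cons a) mulgA ap.
have lv : (len (word v * q)%g <= n)%N by rewrite -ltnS -(len_cons b) mulgA bq.
have [|l1 l1P] := IHn _ lu (word u) (word (c a b)) (ldvd_mulr _ _).
  by rewrite upz; exact: ldvd_mulr.
have [ul1 [l2 cl1] l1min] := l1P.
have cl2 : a ** l1 = b ** (word (c b a) * l2).
  by rewrite -cl1 !mulgA -!word_cons c_compl.
have [t l1t] : ldvd l1 (word u * p).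
  by apply: l1min; [exact: ldvd_mulr|rewrite upz; exact: ldvd_mulr].
have [|l3 l3P] := IHn _ lv (word v) (word (c b a) * l2) (ldvd_mulr _ _).
  exists t; apply: (@presented_cancell (word [:: b])).
  by rewrite mulgA -cl2 -mulgA l1t mulgA ap mulgA bq.
have l1lcm : is_lcm (@ldvd M) (a ** word u) (b ** 1) (a ** l1).
  split; [exact: ldvd_mul2l|by rewrite mulg1 cl2; exact: ldvd_mulr|].
  move=> n' [p' <-] [q']; rewrite mulg1 -mulgA => /esym/cons_eq_compl[z' [up' _]].
  apply: ldvd_mul2l; apply: l1min; first exact: ldvd_mulr.
  by rewrite up'; exact: ldvd_mulr.
have [vl3 l2l3 l3min] := is_lcm_mul2l presented_cancell (word [:: b]) l3P.
rewrite -cl2 in l2l3 l3min; exists (b ** l3); split=> //.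
  by apply: ldvd_trans l2l3; case: l1lcm.
move=> n' un' vn'; apply: l3min => //; case: l1lcm => _ _; apply=> //.
by rewrite mulg1; apply: ldvd_trans vn'; exact: ldvd_mulr.
Qed.

End HomogeneousPresentation.

(** * The braid presentation as a complemented presentation *)

Section BraidPresentation.
Variables e r : nat.
Local Notation G := (gen e r).
Local Notation M := (braid_monoid e r).
Local Notation word := (@word _ (@braid_rel e r)).
Local Notation "a ** x" := (word [:: a] * x) (at level 38, right associativity).
Implicit Types (a b d : G) (i k : 'I_e) (j l : sindex r) (x y z w : M).

Lemma idx_inj : injective (@idx r).
Proof. by move=> j l /val_inj/val_inj. Qed.

Lemma idx_ge3 j : (3 <= idx j)%N.
Proof. exact: (valP j). Qed.

Definition shift a : G := if a is inl i then inl (ord_pred i) else a.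

(* [label a b] is the length of the relation between [a] and [b], except that
   it is 0 for two distinct letters of [T_e]. *)
Definition label a b : nat :=
  match a, b with
  | inl i, inl k => (i == k)
  | inl _, inr j | inr j, inl _ => if idx j == 3 then 3 else 2
  | inr j, inr l =>
      if j == l then 1%N
      else if (idx j == (idx l).+1) || (idx l == (idx j).+1) then 3 else 2
  end.

Definition compl a b : seq G :=
  match label a b with
  | 0 => [:: shift a]
  | 1 => [::]
  | 2 => [:: b]
  | _ => [:: b; a]
  end.

Lemma labelC a b : label a b = label b a.
Proof.
by case: a b => [i|j] [k|l] //=; [rewrite eq_sym|rewrite eq_sym orbC].
Qed.

Lemma label_le3 a b : (label a b <= 3)%N.
Proof. by case: a b => [i|j] [k|l] /=; do ?case: ifP => // _; case: eqP. Qed.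

Lemma label_eq1 a b : label a b = 1%N -> a = b.
Proof.
case: a b => [i|j] [k|l] //=; try by case: ifP.
  by case: eqP => [->|].
by case: eqP => [->|_] //; case: ifP.
Qed.

Lemma labelaa a : label a a = 1%N.
Proof. by case: a => [i|j] /=; rewrite eqxx. Qed.

(** Here [a] and [b] lie in [T_e] and [d] does not; all letters of [T_e] are related to [d] in the
    same way. *)
Lemma label_eq0_congr a b d :
  label a b = 0%N -> (1 < label a d)%N -> label b d = label a d.
Proof.
case: a b => [i|j] [k|l] //=; try by case: ifP.
  by case: d => [h|h] //=; case: (i == h).
by do 2?case: ifP.
Qed.

Lemma label_eq0_trans a b d :
  label a b = 0%N -> label b d = 0%N -> (label a d <= 1)%N.
Proof.
case: a b => [i|j] [k|l] //=; try by do 2?case: ifP.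
by case: d => [h|h] //=; [move=> _ _; exact: leq_b1 | case: ifP].
Qed.

(** Label 3 only joins neighbours on the line [T_e], [s_3], ..., [s_r], which has no triangle. *)
Lemma label_neq333 a b d :
  label a b = 3 -> label b d = 3 -> label a d <> 3.
Proof.
case: a b d => [i|j] [k|l] [h|h] //=; do ?[by case: eqP]; do ?case: ifP => //; lia.
Qed.

Lemma label_shift a b : (1 < label a b)%N -> label (shift a) b = label a b.
Proof. by case: a b => [i|j] [k|l] //=; case: eqP. Qed.

Lemma label_shift_shift a b : label a b = 0%N -> label (shift a) (shift b) = 0%N.
Proof.
case: a b => [i|j] [k|l] //=.
by rewrite (inj_eq (@ord_pred_inj e)).
Qed.

(** Two distinct letters in [T_e] force [e >= 2], so that [i - 1] differs from [i]. *)
Lemma label_shiftr a b : label a b = 0%N -> label a (shift a) = 0%N.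
Proof.
case: a b => [i|j] [k|l] //=; try by do 2?case: ifP.
case: eqP => // neq_ik _; case: eqP => // /(congr1 val) /= eq_i.
case: neq_ik; apply: ord_inj.
have := ltn_ord i; have := ltn_ord k; case: (posnP i) eq_i => [->|i_gt0].
  by move=> + ltke lt0e; rewrite add0n modn_small; lia.
move=> + ltke ltie.
by rewrite (_ : (i + e).-1 = i.-1 + e)%N ?modnDr ?modn_small; lia.
Qed.

Lemma braid_rel_compl_cong a b :
  pres_cong (@braid_rel e r) (a :: compl a b) (b :: compl b a).
Proof.
rewrite /compl (labelC b); case: a b => [i|j] [k|l] /=.
- case: eqP => [->|_]; first exact: pres_cong_refl.
  exact/pres_cong_rel/braid_R5.
- case: eqP => [l3|l3]; first exact/pres_cong_sym/pres_cong_rel/braid_R3.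
  by apply/pres_cong_sym/pres_cong_rel/braid_R4; have := idx_ge3 l; lia.
- case: eqP => [j3|j3]; first exact/pres_cong_rel/braid_R3.
  by apply/pres_cong_rel/braid_R4; have := idx_ge3 j; lia.
- case: eqP => [->|neq_jl]; first exact: pres_cong_refl.
  case: ifP => jl; apply/pres_cong_rel; [apply: braid_R1|apply: braid_R2]; first lia.
  have : idx j <> idx l by move/idx_inj.
  by lia.
Qed.

Lemma word_compl a b : word (a :: compl a b) = word (b :: compl b a).
Proof. exact/word_eqP/braid_rel_compl_cong. Qed.

Lemma label2_rel a b x : label a b = 2 -> a ** b ** x = b ** a ** x.
Proof.
move=> lab; have := foldr_word_cong x (braid_rel_compl_cong a b).
by rewrite /compl (labelC b) lab.
Qed.

Lemma label3_rel a b x : label a b = 3 -> a ** b ** a ** x = b ** a ** b ** x.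
Proof.
move=> lab; have := foldr_word_cong x (braid_rel_compl_cong a b).
by rewrite /compl (labelC b) lab.
Qed.

Lemma label0_rel a b x : label a b = 0%N -> a ** shift a ** x = b ** shift b ** x.
Proof.
move=> lab; have := foldr_word_cong x (braid_rel_compl_cong a b).
by rewrite /compl (labelC b) lab.
Qed.

Lemma braid_rel_size (u v : seq G) : braid_rel u v -> size u = size v.
Proof. by case. Qed.

Lemma braid_rel_compl (u v : seq G) : braid_rel u v ->
  u = v \/ exists a b, u = a :: compl a b /\ v = b :: compl b a.
Proof.
case=> [i j ij|i j ij|j i j3|j i j4|i j].
- right; exists (sgen e i), (sgen e j); rewrite /compl (labelC (sgen e j)) /=.
  have -> : (i == j) = false by apply/eqP=> eq_ij; rewrite eq_ij in ij; lia.
  by have -> : (idx i == (idx j).+1) || (idx j == (idx i).+1) by lia.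
- right; exists (sgen e i), (sgen e j); rewrite /compl (labelC (sgen e j)) /=.
  have -> : (i == j) = false by apply/eqP=> eq_ij; rewrite eq_ij in ij; lia.
  by have -> : (idx i == (idx j).+1) || (idx j == (idx i).+1) = false by lia.
- by right; exists (sgen e j), (tgen r i); rewrite /compl /= j3.
- right; exists (sgen e j), (tgen r i); rewrite /compl /=.
  by have -> : (idx j == 3) = false by lia.
- have [->|neq_ij] := eqVneq i j; [by left|right].
  by exists (tgen r i), (tgen r j); rewrite /compl /= (eq_sym j) (negPf neq_ij).
Qed.

Local Notation len := (@len _ (@braid_rel e r)).

Lemma braid_len_cons a x : len (a ** x) = (len x).+1.
Proof. exact/len_cons/braid_rel_size. Qed.

Lemma compl_eqP a b x y :
  compl_eq compl a b x y <->
  match label a b with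
  | 0 => exists z, x = shift a ** z /\ y = shift b ** z
  | 1 => x = y
  | 2 => exists z, x = b ** z /\ y = a ** z
  | _ => exists z, x = b ** a ** z /\ y = a ** b ** z
  end.
Proof.
rewrite /compl_eq /compl (labelC b); case: (label a b) => [|[|[|n]]] //.
- split=> [[z [-> ->]]|->]; first by rewrite word_nil mul1g.
  by exists y; rewrite word_nil mul1g.
- by split=> -[z [-> ->]]; exists z; rewrite !mulgA -!word_cat.
Qed.

(** * The cube condition, by labels of the pairs of letters *)

Section Cube.
Variable n : nat.
Hypothesis H :
  forall a b x y, a ** x = b ** y -> (len x < n)%N -> compl_eq compl a b x y.

Lemma cons_eq0 a b x y : label a b = 0%N -> a ** x = b ** y -> (len x < n)%N ->
  exists z, x = shift a ** z /\ y = shift b ** z.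
Proof. by move=> lab xy lx; have /compl_eqP := H xy lx; rewrite lab. Qed.

Lemma cons_eq1 a x y : a ** x = a ** y -> (len x < n)%N -> x = y.
Proof. by move=> xy lx; have /compl_eqP := H xy lx; rewrite labelaa. Qed.

Lemma cons_eq2 a b x y : label a b = 2 -> a ** x = b ** y -> (len x < n)%N ->
  exists z, x = b ** z /\ y = a ** z.
Proof. by move=> lab xy lx; have /compl_eqP := H xy lx; rewrite lab. Qed.

Lemma cons_eq3 a b x y : label a b = 3 -> a ** x = b ** y -> (len x < n)%N ->
  exists z, x = b ** a ** z /\ y = a ** b ** z.
Proof. by move=> lab xy lx; have /compl_eqP := H xy lx; rewrite lab. Qed.

Ltac solve_len ly := move: ly; rewrite ?braid_len_cons; lia.

(** Since [y] begins with both [a] and [d], the assumption [H] relates the tails [z] and [z']; the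
    letter [b] then slides past the letters of that relation. *)
Lemma cube22 a b d x y w : (len y <= n)%N -> label a b = 2 -> label b d = 2 ->
  compl_eq compl a b x y -> compl_eq compl b d y w -> compl_eq compl a d x w.
Proof.
move=> ly lab lbd /compl_eqP; rewrite lab => -[z [-> def_y]].
move=> /compl_eqP; rewrite lbd => -[z' [def_y' ->]].
rewrite {}def_y in ly def_y' *.
have /compl_eqP zz' : compl_eq compl a d z z' by apply: H => //; solve_len ly.
apply/compl_eqP; case lad: (label a d) zz' => [|[|[|m]]].
- move=> [v [-> ->]]; exists (b ** v).
  have ldb : label d b = 2 by rewrite labelC.
  by split; rewrite -label2_rel // label_shift ?lab ?ldb.
- by move->.
- move=> [v [-> ->]]; exists (b ** v).
  by split; apply/esym/label2_rel; rewrite // labelC.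
- move=> [v [-> ->]]; exists (b ** v).
  split; first by rewrite (label2_rel _ lbd) -(label2_rel _ lab).
  by rewrite -(label2_rel _ lab) (label2_rel _ lbd).
Qed.

Lemma cube32 a b d x y w : (len y <= n)%N -> label a b = 3 -> label b d = 2 ->
  compl_eq compl a b x y -> compl_eq compl b d y w -> compl_eq compl a d x w.
Proof.
move=> ly lab lbd /compl_eqP; rewrite lab => -[z [-> def_y]].
move=> /compl_eqP; rewrite lbd => -[z' [def_y' ->]].
rewrite {}def_y in ly def_y' *.
have lba : label b a = 3 by rewrite labelC.
have ldb : label d b = 2 by rewrite labelC.
have : compl_eq compl a d (b ** z) z' by apply: H => //; solve_len ly.
move=> /compl_eqP bzz'; apply/compl_eqP; case lad: (label a d) bzz' => [|[|[|m]]].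
- by have := label_eq0_congr (d := b) lad; rewrite lab ldb => /(_ isT).
- by rewrite (label_eq1 lad) labelC lbd in lab.
- move=> [v [bz ->]]; have [|v' [-> ->]] := cons_eq2 lbd bz; first by solve_len ly.
  exists (b ** a ** v'); split.
    by rewrite (label2_rel _ lad) (label2_rel _ lbd).
  by rewrite (label3_rel _ lba).
(* The letters [b], [a], [d] behave as in type A_3 with [a] in the middle: [x] turns out to begin
   with [b a d a b], so that [a ** x] begins with the length 6 word [a b a d a b] of the
   half-turn. *)
- have {}lad : label a d = 3 by have := label_le3 a d; lia.
  move=> [v [bz ->]]; have [|v' [def_z av]] := cons_eq2 lbd bz; first by solve_len ly.
  rewrite {}def_z in ly bz *.
  have [|v'' [def_v' ->]] := cons_eq3 lba (esym av).
    by have := congr1 len av; solve_len ly.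
  rewrite {}def_v'; exists (b ** a ** d ** v''); split.
    by rewrite (label3_rel _ lad) (label3_rel _ lab) !(label2_rel _ ldb).
  have lda : label d a = 3 by rewrite labelC.
  by rewrite !(label2_rel _ ldb) (label3_rel _ lba) (label3_rel _ lda).
Qed.

(* The relations say that [a ** shift a] does not depend on the letter [a] of
   [T_e], so that [b ** a ** shift a ** b] commutes with [T_e] up to [shift]. *)
Lemma label3_slide a b x : label b a = 3 -> label a (shift a) = 0%N ->
  b ** a ** shift a ** b ** shift (shift a) ** x =
  shift a ** b ** a ** shift a ** b ** x.
Proof.
move=> lba lasa.
have lsab : label (shift a) b = 3 by rewrite label_shift labelC lba.
have lbssa : label b (shift (shift a)) = 3 by rewrite labelC label_shift lsab.
by rewrite !(label0_rel _ lasa) (label3_rel _ lsab) (label3_rel _ lbssa).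
Qed.

Lemma cube33 a b d x y w : (len y <= n)%N -> label a b = 3 -> label b d = 3 ->
  compl_eq compl a b x y -> compl_eq compl b d y w -> compl_eq compl a d x w.
Proof.
move=> ly lab lbd /compl_eqP; rewrite lab => -[z [-> def_y]].
move=> /compl_eqP; rewrite lbd => -[z' [def_y' ->]].
rewrite {}def_y in ly def_y' *.
have lba : label b a = 3 by rewrite labelC.
have ldb : label d b = 3 by rewrite labelC.
have : compl_eq compl a d (b ** z) (b ** z') by apply: H => //; solve_len ly.
move=> /compl_eqP bzz'; apply/compl_eqP; case lad: (label a d) bzz' => [|[|[|m]]].
(* Here [a] and [d] are distinct letters of [T_e]. Both tails contain [b ** a ** shift a ** b],
   which is unchanged when [d] replaces [a], and [label3_slide] brings a letter of [T_e] to its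
   left. *)
- move=> [v [bz bz']].
  have lbsa : label b (shift a) = 3 by rewrite labelC label_shift ?lab.
  have lsdb : label (shift d) b = 3 by rewrite label_shift ldb.
  have [|v1 [def_z def_v]] := cons_eq3 lbsa bz; first by solve_len ly.
  rewrite {}def_z {}def_v in ly bz bz' *.
  have [|v2 [/cons_eq1 v12 ->]] := cons_eq3 lsdb (esym bz'); first by solve_len ly.
  have [|v3 [-> ->]] := cons_eq0 (label_shift_shift lad) (v12 ltac:(solve_len ly)).
    by solve_len ly.
  have lda : label d a = 0%N by rewrite labelC.
  exists (b ** a ** shift a ** b ** v3); split.
    by rewrite label3_slide // (label_shiftr lad).
  by rewrite (label0_rel _ lad) label3_slide // (label_shiftr lda).
- move=> /cons_eq1-> //; last by solve_len ly.
  by rewrite (label_eq1 lad).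
- move=> [v [bz bz']]; have lda : label d a = 2 by rewrite labelC.
  have [|v1 [def_z def_v]] := cons_eq3 lbd bz; first by solve_len ly.
  rewrite {}def_z {}def_v in ly bz bz' *.
  have [|v2 [/cons_eq1 v12 ->]] := cons_eq3 lab (esym bz'); first by solve_len ly.
  have [|v3 [-> ->]] := cons_eq2 lda (v12 ltac:(solve_len ly)).
    by solve_len ly.
  exists (b ** d ** a ** b ** v3); split.
    by rewrite (label2_rel _ lad) (label3_rel _ lab) (label3_rel _ lbd).
  by rewrite !(label2_rel _ lda) (label3_rel _ lab) (label3_rel _ ldb).
- by have := label_neq333 lab lbd; have := label_le3 a d; lia.
Qed.

Lemma cube00 a b d x y w : (len y <= n)%N -> label a b = 0%N -> label b d = 0%N ->
  compl_eq compl a b x y -> compl_eq compl b d y w -> compl_eq compl a d x w.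
Proof.
move=> ly lab lbd /compl_eqP; rewrite lab => -[z [-> def_y]].
move=> /compl_eqP; rewrite lbd => -[z' [def_y' ->]].
rewrite {}def_y in ly def_y' *.
have -> : z = z' by apply: cons_eq1 def_y' _; solve_len ly.
apply/compl_eqP; have := label_eq0_trans lab lbd.
case lad: (label a d) => [|[|m]] // _; first by exists z'.
by rewrite (label_eq1 lad).
Qed.

Lemma cube02 a b d x y w : (len y <= n)%N -> label a b = 0%N -> label b d = 2 ->
  compl_eq compl a b x y -> compl_eq compl b d y w -> compl_eq compl a d x w.
Proof.
move=> ly lab lbd /compl_eqP; rewrite lab => -[z [-> def_y]].
move=> /compl_eqP; rewrite lbd => -[z' [def_y' ->]].
rewrite {}def_y in ly def_y' *.
have lad : label a d = 2.
  by rewrite -lbd; apply: label_eq0_congr; rewrite ?lbd // labelC.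
have [||v [-> ->]] := cons_eq2 _ def_y'; [by rewrite label_shift lbd|by solve_len ly|].
apply/compl_eqP; rewrite lad; exists (shift a ** v).
by rewrite (label0_rel _ lab) label2_rel // label_shift lad.
Qed.

(** With [d] in the role of [s_3], the common multiple [a ** x] begins with
    [a (shift a) d a (shift a) d], that is, with L_2 L_3. *)
Lemma cube03 a b d x y w : (len y <= n)%N -> label a b = 0%N -> label b d = 3 ->
  compl_eq compl a b x y -> compl_eq compl b d y w -> compl_eq compl a d x w.
Proof.
move=> ly lab lbd /compl_eqP; rewrite lab => -[z [-> def_y]].
move=> /compl_eqP; rewrite lbd => -[z' [def_y' ->]].
rewrite {}def_y in ly def_y' *.
have lba : label b a = 0%N by rewrite labelC.
have lad : label a d = 3 by rewrite -lbd; apply: label_eq0_congr; rewrite ?lbd // labelC.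
have lda : label d a = 3 by rewrite labelC.
have lasa := label_shiftr lab; have lbsb := label_shiftr lba.
have lsbd : label (shift b) d = 3 by rewrite label_shift lbd.
have ldsa : label d (shift a) = 3 by rewrite labelC label_shift lad.
have ldssb : label d (shift (shift b)) = 3 by rewrite labelC label_shift lsbd.
have [|v [def_z bz']] := cons_eq3 lsbd def_y'; first by solve_len ly.
rewrite {}def_z in ly def_y' *.
have [|v' [def_dv ->]] := cons_eq0 (etrans (labelC _ _) lbsb) (esym bz').
  by solve_len ly.
have [|v'' [def_v ->]] := cons_eq3 ldssb def_dv; first by solve_len ly.
rewrite {}def_v.
apply/compl_eqP; rewrite lad; exists (shift a ** d ** shift (shift a) ** v''); split.
  by rewrite (label3_slide _ lda lasa) !(label0_rel _ lasa)
             (label0_rel _ (label_shift_shift lba)).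
have ldsb : label d (shift b) = 3 by rewrite labelC.
by rewrite (label3_rel _ ldsb) (label3_rel _ ldsa) !(label0_rel _ lba)
           (label0_rel _ (label_shift_shift lba)).
Qed.

(** Label 1 identifies two of the letters. The condition is symmetric under exchanging ([a], [x])
    with ([d], [w]), so six pairs of labels suffice for the rest. *)
Lemma braid_cube a b d x y w : (len y <= n)%N ->
  compl_eq compl a b x y -> compl_eq compl b d y w -> compl_eq compl a d x w.
Proof.
move=> ly Hab Hbd; have Hba := compl_eq_sym Hab; have Hdb := compl_eq_sym Hbd.
have [le_ab le_bd] := (label_le3 a b, label_le3 b d).
case lab: (label a b) le_ab => [|[|[|[|?]]]] // _.
all: case lbd: (label b d) le_bd => [|[|[|[|?]]]] // _.
all: try by move: Hbd => /compl_eqP; rewrite lbd => <-; rewrite -(label_eq1 lbd).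
all: try by move: Hab => /compl_eqP; rewrite lab => ->; rewrite (label_eq1 lab).
all: have ldb := lbd; rewrite labelC in ldb; have lba := lab; rewrite labelC in lba.
- exact: (cube00 ly lab lbd).
- exact: (cube02 ly lab lbd).
- exact: (cube03 ly lab lbd).
- exact/compl_eq_sym/(cube02 ly ldb lba).
- exact: (cube22 ly lab lbd).
- exact/compl_eq_sym/(cube32 ly ldb lba).
- exact/compl_eq_sym/(cube03 ly ldb lba).
- exact: (cube32 ly lab lbd).
- exact: (cube33 ly lab lbd).
Qed.

End Cube.

Lemma compl_id a : compl a a = [::].
Proof. by rewrite /compl labelaa. Qed.

Lemma braid_cancell x y z : x * y = x * z -> y = z.
Proof.
exact: (presented_cancell braid_rel_size compl_id braid_rel_compl braid_cube).
Qed.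

Lemma braid_lcm x y m :
  ldvd x m -> ldvd y m -> exists p, is_lcm (@ldvd M) x y p.
Proof.
exact: (presented_lcm braid_rel_size compl_id braid_rel_compl word_compl braid_cube).
Qed.

(** * The anti-automorphism exchanging left and right divisibility *)

Definition flip a : G := if a is inl i then inl (rev_ord i) else a.

Lemma rev_ord_pred i : ord_pred (rev_ord (ord_pred i)) = rev_ord i.
Proof.
apply: ord_inj => /=; have := ltn_ord i; case: (posnP i) => [->|i_gt0] lt_ie.
  by rewrite add0n (modn_small (_ : e.-1 < e)%N) ?modn_small; lia.
rewrite (_ : (i + e).-1 = i.-1 + e)%N ?modnDr ?(modn_small (_ : i.-1 < e)%N); try lia.
rewrite (_ : (e - i.-1.+1 + e).-1 = (e - i.+1) + e)%N ?modnDr; last by lia.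
by rewrite modn_small; lia.
Qed.

Lemma flipK : involutive flip.
Proof. by case=> [i|j] //=; rewrite rev_ordK. Qed.

Lemma braid_cong_rev (u v : seq G) : pres_cong (@braid_rel e r) u v ->
  pres_cong (@braid_rel e r) (map flip (rev u)) (map flip (rev v)).
Proof.
elim=> {u v} [u v|u|u v _|u v w _ uv _|u u' v v' _ uu' _ vv'].
- case=> [i j ij|i j ij|j i j3|j i j4|i k]; rewrite /rev /=.
  + exact/pres_cong_rel/braid_R1.
  + by apply/pres_cong_sym/pres_cong_rel/braid_R2.
  + exact/pres_cong_rel/braid_R3.
  + exact/pres_cong_sym/pres_cong_rel/braid_R4.
  (* The reversed word starts with the letter of index [rev_ord (ord_pred i)], whose predecessor is
     [rev_ord i]; this is again a side of (R5). *)
  + rewrite -(rev_ord_pred i) -(rev_ord_pred k).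
    exact/pres_cong_rel/braid_R5.
- exact: pres_cong_refl.
- exact: pres_cong_sym.
- exact: pres_cong_trans.
- by rewrite !rev_cat !map_cat; exact: pres_cong_cat.
Qed.

Definition bar x : M := word (map flip (rev (repr x))).

Lemma bar_word (u : seq G) : bar (word u) = word (map flip (rev u)).
Proof. by apply/word_eqP/braid_cong_rev/word_eqP; exact: reprK. Qed.

Lemma barM x y : bar (x * y) = bar y * bar x.
Proof.
have [u ->] := word_surj x; have [v ->] := word_surj y.
by rewrite -word_cat !bar_word rev_cat map_cat word_cat.
Qed.

Lemma barK : involutive bar.
Proof.
move=> x; have [u ->] := word_surj x.
by rewrite !bar_word -map_rev revK (mapK flipK).
Qed.

End BraidPresentation.

(** * The elements L_k and their product Delta *)

Section FundamentalElement.
Variables e r : nat.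
Variable i0 : 'I_e.
Local Notation M := (braid_monoid e r).
Local Notation word := (@word _ (@braid_rel e r)).
Implicit Types (i : 'I_e) (j k l n : nat) (a b x y z : M).

Definition tlet i : M := word [:: tgen r i].

(* Junk value 1 when [k] is not in the range from 3 to [r]. *)
Definition slet k : M :=
  if [pick j : sindex r | idx j == k] is Some j then word [:: sgen e j] else 1.

(** Commutation in a form that rewrites inside right-nested products. *)
Lemma commuteA x y z : commute x y -> x * (y * z) = y * (x * z).
Proof. by move=> xy; rewrite !mulgA xy. Qed.

Lemma commute_braid_conj a b x : a * (b * a) = b * (a * b) -> commute b x ->
  commute a (b * ((a * (x * a)) * b)).
Proof.
move=> braid bx; have braidA z : a * (b * (a * z)) = b * (a * (b * z)).
  by rewrite (mulgA b) (mulgA a) braid -!mulgA.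
by rewrite /commute -!mulgA braidA (commuteA _ bx) braid.
Qed.

Variant slet_spec k : M -> Prop :=
  | SletOut of ~~ (3 <= k <= r)%N : slet_spec k 1
  | SletIn (j : sindex r) of idx j = k : slet_spec k (word [:: sgen e j]).

Lemma sletP k : slet_spec k (slet k).
Proof.
rewrite /slet; case: pickP => [j /eqP jk|noj]; constructor=> //.
apply/negP=> /andP[le3k lekr].
by have := noj (exist _ (Ordinal (lekr : (k < r.+1)%N)) le3k); rewrite /idx eqxx.
Qed.

Lemma slet_idx (j : sindex r) : slet (idx j) = word [:: sgen e j].
Proof.
case: sletP => [|l /idx_inj-> //]; rewrite idx_ge3 /=.
by have := ltn_ord (val j); rewrite ltnS /idx => ->.
Qed.

Lemma slet_slet_comm k l : (k.+1 < l)%N -> commute (slet k) (slet l).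
Proof.
case: sletP => [_ _|j <-]; first exact/commute_sym/commute1.
case: sletP => [_ _|h <- lt_kl]; first exact: commute1.
by rewrite /commute -!word_cat; apply/word_eqP/pres_cong_rel/braid_R2; lia.
Qed.

Lemma slet_tlet_comm k i : (3 < k)%N -> commute (slet k) (tlet i).
Proof.
case: sletP => [_ _|j <- lt3k]; first exact/commute_sym/commute1.
by rewrite /commute -!word_cat; apply/word_eqP/pres_cong_rel/braid_R4.
Qed.

Lemma slet_slet_braid k : (3 <= k)%N -> (k < r)%N ->
  slet k * (slet k.+1 * slet k) = slet k.+1 * (slet k * slet k.+1).
Proof.
case: sletP => [|j <-]; first by lia.
case: sletP => [|h hj _ _]; first by lia.
have eq1 : absz (Posz (idx j) - Posz (idx h)) = 1%N by lia.
by have := foldr_word_cong 1 (pres_cong_rel (braid_R1 e eq1)); rewrite /= !mulg1.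
Qed.

Lemma slet3_tlet_braid i : (3 <= r)%N ->
  slet 3 * (tlet i * slet 3) = tlet i * (slet 3 * tlet i).
Proof.
case: sletP => [|j j3 _]; first by lia.
by have := foldr_word_cong 1 (pres_cong_rel (braid_R3 i j3)); rewrite /= !mulg1.
Qed.

Fixpoint lam k : M :=
  if k is k'.+1 then slet k.+2 * (lam k' * slet k.+2)
  else tlet i0 * tlet (ord_pred i0).

Fixpoint delta k : M := if k is k'.+1 then delta k' * lam k else lam 0.

Lemma lamS k : lam k.+1 = slet k.+3 * (lam k * slet k.+3).
Proof. by []. Qed.

Lemma deltaS k : delta k.+1 = delta k * lam k.+1.
Proof. by []. Qed.

Lemma lam0E i : lam 0 = tlet i * tlet (ord_pred i).
Proof. by rewrite /= -!word_cat; apply/word_eqP/pres_cong_rel/braid_R5. Qed.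

Lemma tlet_lam0 i : tlet i * lam 0 = lam 0 * tlet (ord_pred (ord_pred i)).
Proof. by rewrite [in LHS](lam0E (ord_pred i)) (lam0E i) mulgA. Qed.

Lemma tlet_lam k i : (k.+3 <= r)%N ->
  tlet i * lam k.+1 = lam k.+1 * tlet (ord_pred i).
Proof.
elim: k => [|k IH] lek.
  rewrite lamS (lam0E i) -!mulgA -slet3_tlet_braid //.
  by rewrite !mulgA -(mulgA (tlet i)) -slet3_tlet_braid // !mulgA.
rewrite [lam k.+2]lamS; move: (lam k.+1) {IH}(IH (ltnW lek)) => L tL.
rewrite -!mulgA (slet_tlet_comm (k := k.+4)) // -(commuteA _ (slet_tlet_comm _ _)) //.
by rewrite (mulgA (tlet i)) tL -!mulgA.
Qed.

Lemma slet_lam_hi j k : (k.+3 < j)%N -> commute (slet j) (lam k).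
Proof.
elim: k => [|k IH] ltkj.
  by apply: commuteM; apply: slet_tlet_comm.
have jk := commute_sym (slet_slet_comm (k := k.+3) (l := j) ltac:(lia)).
by apply: commuteM => //; apply: commuteM => //; apply: IH; lia.
Qed.

Lemma slet_lam_lo j k : (3 <= j)%N -> (j < k.+2)%N -> (k.+2 <= r)%N ->
  commute (slet j) (lam k).
Proof.
elim: k => [|k IH] le3j ltjk lekr; first by lia.
have [ltj|eqj] : (j < k.+2)%N \/ j = k.+2 by lia.
  have jk := slet_slet_comm (k := j) (l := k.+3) ltac:(lia).
  by apply: commuteM => //; apply: commuteM => //; apply: IH; lia.
case: k {IH ltjk} eqj lekr => [|k] eqj lekr; first by lia.
rewrite eqj; apply: commute_braid_conj; last exact: slet_lam_hi.
by apply: slet_slet_braid; lia.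
Qed.

Lemma lam_comm k l : (k < l)%N -> (l.+2 <= r)%N -> commute (lam k) (lam l).
Proof.
case: l => // l ltkl lelr; elim: k ltkl => [|k IH] ltkl.
  rewrite /commute {1}(lam0E i0) (lam0E (ord_pred i0)).
  by rewrite -mulgA tlet_lam // mulgA tlet_lam // mulgA.
have cs : commute (lam l.+1) (slet k.+3).
  by apply/commute_sym/slet_lam_lo => //; lia.
apply/commute_sym/commuteM => //; apply: commuteM => //.
by apply/commute_sym/IH/ltnW.
Qed.

Lemma delta_lam_comm k l : (k < l)%N -> (l.+2 <= r)%N -> commute (delta k) (lam l).
Proof.
move=> + lelr; elim: k => [|k IH] ltkl; first exact: lam_comm.
apply/commute_sym/commuteM; first exact/commute_sym/IH/ltnW.
exact/commute_sym/lam_comm.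
Qed.

Lemma slet_lam_lam k : (k.+3 <= r)%N -> commute (slet k.+3) (lam k * lam k.+1).
Proof.
by move=> lekr; rewrite /commute [in RHS](lam_comm (ltnSn k)) //= !mulgA.
Qed.

Lemma slet_delta_hi j k : (k.+3 < j)%N -> commute (slet j) (delta k).
Proof.
elim: k => [|k IH] ltkj; first exact: slet_lam_hi.
by apply: commuteM; [apply: IH; lia|exact: slet_lam_hi].
Qed.

Lemma slet_delta j k : (3 <= j <= k.+2)%N -> (k.+2 <= r)%N ->
  commute (slet j) (delta k).
Proof.
elim: k => [|k IH] lejk lekr; first by lia.
have [lej|->] : (j <= k.+2)%N \/ j = k.+3 by lia.
  by apply: commuteM; [apply: IH|apply: slet_lam_lo]; lia.
case: k {IH lejk} lekr => [|k] lekr; first exact: slet_lam_lam.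
rewrite !deltaS -mulgA.
by apply: commuteM; [exact: slet_delta_hi|exact: slet_lam_lam].
Qed.

Lemma tlet_delta k i : (k.+2 <= r)%N ->
  tlet i * delta k = delta k * tlet (iter k.+2 (@ord_pred e) i).
Proof.
elim: k => [|k IH] lekr; first by rewrite [delta 0]/(lam 0) tlet_lam0.
by rewrite deltaS mulgA (IH (ltnW lekr)) -mulgA tlet_lam // mulgA.
Qed.

Lemma delta_dvd k l : (k <= l)%N -> ldvd (delta k) (delta l).
Proof.
move=> /subnK <-; elim: (l - k)%N => [|n IH]; first exact: ldvd_refl.
by apply: ldvd_trans IH _; exists (lam (n + k).+1).
Qed.

Lemma tlet_dvd_delta i k : ldvd (tlet i) (delta k).
Proof.
apply: ldvd_trans (delta_dvd (leq0n k)).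
by exists (tlet (ord_pred i)); rewrite -lam0E.
Qed.

Lemma slet_dvd_delta j k : (3 <= j <= k.+2)%N -> (k.+2 <= r)%N ->
  ldvd (slet j) (delta k).
Proof.
case: j => [|[|[|j]]] // lejk lekr.
apply: ldvd_trans (delta_dvd (k := j.+1) _); last by lia.
rewrite deltaS delta_lam_comm //; last by lia.
by rewrite /= -!mulgA; exact: ldvd_mulr.
Qed.

End FundamentalElement.

Section BraidGarside.
Variables e r : nat.
Hypotheses (he : (1 <= e)%N) (hr : (2 <= r)%N).
Local Notation M := (braid_monoid e r).
Local Notation letter a := (word (@braid_rel e r) [:: a]).
Implicit Types x y z : M.

Let D : M := delta r (Ordinal he) (r - 2).

Lemma letter_slet (j : sindex r) : letter (sgen e j) = slet e r (idx j).
Proof. by rewrite slet_idx. Qed.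

Lemma idx_bounds (j : sindex r) : (3 <= idx j <= (r - 2).+2)%N.
Proof.
by rewrite idx_ge3 /= -addn2 subnK //; have := ltn_ord (val j); rewrite ltnS.
Qed.

Lemma D_pushl a : exists x, letter a * D = D * x.
Proof.
have ler : ((r - 2).+2 <= r)%N by lia.
case: a => [i|j]; first by eexists; exact: tlet_delta.
by rewrite [inr j]/(sgen e j) letter_slet; eexists; apply/slet_delta/ler/idx_bounds.
Qed.

Lemma D_pushr a : exists x, x * D = D * letter a.
Proof.
have ler : ((r - 2).+2 <= r)%N by lia.
case: a => [i|j]; last first.
  by rewrite [inr j]/(sgen e j) letter_slet; eexists; apply/slet_delta/ler/idx_bounds.
exists (tlet r (iter (r - 2).+2 (@ordS e) i)); rewrite tlet_delta //; congr (_ * tlet _ _).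
by elim: (_.+2) => // n IH; rewrite iterSr /= ordSK.
Qed.

Lemma letter_dvd_D a : ldvd (letter a) D.
Proof.
have ler : ((r - 2).+2 <= r)%N by lia.
case: a => [i|j]; first exact: tlet_dvd_delta.
by rewrite [inr j]/(sgen e j) letter_slet; apply/slet_dvd_delta/ler/idx_bounds.
Qed.

Lemma braid_cancellative : cancellative M.
Proof.
split=> [|x y z /(congr1 (@bar e r))]; first exact: braid_cancell.
rewrite !barM => /braid_cancell/(congr1 (@bar e r)).
by rewrite !barK.
Qed.

Lemma finite_ldvd x : finite_set [set y | ldvd y x]%classic.
Proof.
pose N := len x.
apply: (@sub_finite_set _ _ [set word (@braid_rel e r) u | u in setT : set (N.-bseq (gen e r))]%classic).
  move=> y /= [z def_x]; have [u def_y] := word_surj y.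
  have leuN : (size u <= N)%N.
    rewrite /N -def_x (lenM (@braid_rel_size e r)) def_y.
    by rewrite (len_word (@braid_rel_size e r)) leq_addr.
  by exists (Bseq leuN).
exact/finite_image/finite_finset.
Qed.

Lemma ldvd_lcms_gcds : has_lcms_gcds (@ldvd M).
Proof.
have lcms x y : exists m, is_lcm (@ldvd M) x y m.
  have [m [xm ym]] := quasicentral_common_multiple
    (@word_ind _ (@braid_rel e r)) D_pushl letter_dvd_D x y.
  exact: braid_lcm xm ym.
move=> x y; split=> //.
apply: (is_gcd_of_lcms (lenM (@braid_rel_size e r)) _ lcms).
exact: (len_eq0 (@braid_rel_size e r)).
Qed.

Lemma rdvd_bar x y : rdvd x y <-> ldvd (bar x) (bar y).
Proof.
split=> -[z]; first by move=> <-; exists (bar z); rewrite barM.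
by move=> /(congr1 (@bar e r)); rewrite barM !barK => <-; exists (bar z).
Qed.

Lemma rdvd_lcms_gcds : has_lcms_gcds (@rdvd M).
Proof.
move=> x y; have [[m [xm ym mP]] [d [dx dy dP]]] := ldvd_lcms_gcds (bar x) (bar y).
split; [exists (bar m)|exists (bar d)]; split; rewrite ?rdvd_bar ?barK //.
  by move=> n; rewrite !rdvd_bar barK; exact: mP.
by move=> n; rewrite !rdvd_bar barK; exact: dP.
Qed.

End BraidGarside.

Theorem theorem3p2 (e r : nat) (he : (1 <= e)%N) (hr : (2 <= r)%N) :
  garside_monoid (braid_monoid e r).
Proof.
split.
- exact: braid_cancellative.
- exact: ldvd_lcms_gcds.
- exact: rdvd_lcms_gcds.
- exists (delta r (Ordinal he) (r - 2)).
  apply: (quasicentral_garside (@word_ind _ (@braid_rel e r))).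
  + exact: D_pushl.
  + exact: D_pushr.
  + exact: letter_dvd_D.
  + exact: braid_cancellative.
  + exact: finite_ldvd.
Qed.
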